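(* Let $A$ be a complex unital Banach algebra with unit $1$, $\|1\|=1$, and suppose that, as a Banach space, $A$ is the dual of a Banach space $A_{\sharp}$. Then the set $S_n(A)$ of normal states linearly spans $A_{\sharp}$ (over $\mathbb{C}$). Moreover, each $\omega\in A_{\sharp}$ with $\|\omega\|<(e\sqrt{2})^{-1}$ (where $e$ is the base of the natural logarithm) can be written as $$\omega=t_1\omega_1-t_2\omega_2+i(t_3\omega_3-t_4\omega_4),$$ where $\omega_j\in S_n(A)$ and $t_j\in[0,1]$ for $j=1,2,3,4$.
   Context: $A^{\sharp}$ denotes the Banach space dual of $A$. When $A$ is the dual of the Banach space $A_{\sharp}$ (with the norm of $A$ being the dual norm), $A_{\sharp}$ is regarded as a subspace of $A^{\sharp}$ via the canonical embedding, namely as the set of all weak* (i.e. $\sigma(A,A_\sharp)$-) continuous linear functionals on $A$. No compatibility between the multiplication of $A$ and its weak* topology is assumed. The set of states is $S(A)=\{\rho\in A^{\sharp}: \|\rho\|\leq 1,\ \rho(1)=1\}$, and the set of normal states is $S_n(A)=S(A)\cap A_{\sharp}$. *)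

(* Defs.v *)
From HB Require Import structures.
From mathcomp Require Import all_boot all_order all_algebra.
From mathcomp Require Import all_classical all_reals all_analysis.
From mathcomp Require Export complex.

Set Implicit Arguments.
Unset Strict Implicit.
Unset Printing Implicit Defensive.

Import Order.TTheory GRing.Theory Num.Theory.
Import numFieldNormedType.Exports.

Local Open Scope classical_set_scope.
Local Open Scope complex_scope.
Local Open Scope ring_scope.

(* Unital Banach algebras. The ring structure is given by explicit operations,
   since Hierarchy Builder rejects any join of NormedModule with the ring
   structures that is declared after Num.NumDomain.
   The condition |1| = 1 is not part of the structure. *)
HB.mixin Record CompleteNormedModule_isBanachAlgebra (K : numFieldType) A
    of CompleteNormedModule K A := {
  balg_one : A;
  balg_mul : A -> A -> A;
  balg_mulA : associative balg_mul;
  balg_mul1r : left_id balg_one balg_mul;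
  balg_mulr1 : right_id balg_one balg_mul;
  balg_mulDl : left_distributive balg_mul +%R;
  balg_mulDr : right_distributive balg_mul +%R;
  balg_scaleAl : forall (k : K) (x y : A),
    k *: balg_mul x y = balg_mul (k *: x) y;
  balg_scaleAr : forall (k : K) (x y : A),
    k *: balg_mul x y = balg_mul x (k *: y);
  balg_normM : forall x y : A, `|balg_mul x y| <= `|x| * `|y|
}.

#[short(type="banachAlgType")]
HB.structure Definition BanachAlgebra (K : numFieldType) :=
  {A of CompleteNormedModule K A & CompleteNormedModule_isBanachAlgebra K A}.

Arguments balg_one {K} s.

Section Dual.
Variable R : realType.
Implicit Types V : normedModType R[i].

Definition cont_dual V : set (V -> R[i]^o) :=
  [set f : V -> R[i]^o | linear f /\ continuous f].
Arguments cont_dual : clear implicits.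

(* Norms of elements of V and of R[i] are (real) elements of R[i], hence the
   real part. *)
Definition dual_norm V (f : V -> R[i]^o) : R :=
  sup [set complex.Re `|f x| | x in [set x : V | `|x| <= 1]].

(* J exhibits A as the Banach space dual of E. *)
Definition is_dual_of (A E : normedModType R[i]) (J : A -> E -> R[i]^o) :=
  [/\ linear J, range J = cont_dual E
    & forall a, `|a| = (dual_norm (J a))%:C].

(* The image of E in the dual of A under the canonical embedding
   x |-> (a |-> J a x). *)
Definition predual (A E : normedModType R[i]) (J : A -> E -> R[i]^o) :
    set (A -> R[i]^o) :=
  range (fun x a => J a x).

Definition lin_span (K : pzRingType) (V : lmodType K) (S : set V) : set V :=
  [set v | exists (n : nat) (c : 'I_n -> K) (s : 'I_n -> V),
     (forall j, S (s j)) /\ v = \sum_j c j *: s j].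

Definition states (A : banachAlgType R[i]) : set (A -> R[i]^o) :=
  [set rho | [/\ cont_dual A rho, dual_norm rho <= 1 & rho (balg_one A) = 1]].

Definition normal_states (A : banachAlgType R[i]) (E : normedModType R[i])
    (J : A -> E -> R[i]^o) : set (A -> R[i]^o) :=
  @states A `&` predual J.

End Dual.
Arguments cont_dual {R} V _.
Arguments states {R} A _.

(* Main.v *)
Require Import Defs.
From HB Require Import structures.
From mathcomp Require Import all_boot all_order all_algebra.
From mathcomp Require Import all_classical all_reals all_analysis.
From mathcomp Require Import complex.
From mathcomp Require Import ring lra.

Set Implicit Arguments.
Unset Strict Implicit.
Unset Printing Implicit Defensive.

Import Order.TTheory GRing.Theory Num.Theory.
Import numFieldNormedType.Exports.

Local Open Scope classical_set_scope.
Local Open Scope complex_scope.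
Local Open Scope ring_scope.

(** Call [x] in [E] a state vector if evaluation at [x] is a normal state, that
    is, if [|x| <= 1] and [J 1 x = 1]. Because the norm of [A] is the norm of a
    dual space, [1] is almost attained on the unit ball of [E], but it is not
    clear at first that it is attained, i.e. that there are any normal states.

    The multiplication enters through a single property: the norm of [A] is
    differentiable at [1] with a uniform quadratic error. If
    [|1 + s a| <= 1 + s m] for all small [s > 0], then the Euler approximations
    [(1 + (t/n) a)^n] of [exp (t a)] have norm at most [exp (t m)], and expanding
    them gives [|1 + t a| <= 1 + t m + 3 t^2] for [t <= 1/2] and [|a| <= 1]
    (unit_growth_quadratic). As the best [m] can be computed on any slice
    [{x : |x| <= 1, Re J 1 x > 1 - d}] of the unit ball of [E] (slice_growth), a
    Hahn-Banach separation shows that every point of the slice of depth [t^2]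
    is within [5 t] of every thinner slice (slice_step). Iterating with
    geometrically decreasing depths gives a sequence in the complete space [E]
    that converges to a state vector: approximate normal states are close to
    normal states (state_vector_near). Hence the growth of [|1 + s a|] is
    decided by the normal states (state_growth).

    The same Euler approximations, averaged over the directions [a], [i a],
    [- a], [- i a], isolate [a] itself and bound [|a|] by three times the sum of
    the four growth constants (numerical_radius); so [|a|] is at most three
    times the support function at [a] of the convex set [K] of all
    [t1 y1 - t2 y2 + i (t3 y3 - t4 y4)] with state vectors [y_j] and [t_j] in
    [[0, 1]] (norm_le_support). By separation, [K] is dense in the set of
    vectors of functional norm at most [1/3]. Since each of the four sets of
    multiples of state vectors is convex, bounded and norm closed, a geometric
    series of corrections turns density into equality for all vectors of
    functional norm less than [1/3] (four_substates_ball), and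
    [1 / (e sqrt 2) < 1/3]. *)

(** * Dominated linear functionals on real vector spaces *)

Section MazurOrlicz.
Variables (R : realType) (V : lmodType R).
Implicit Types (p q : V -> R) (C : set (V * R)).

Definition sublinear p :=
  (forall x y, p (x + y) <= p x + p y) /\
  (forall l x, 0 <= l -> p (l *: x) <= l * p x).

Definition convex_cone C :=
  [/\ C (0, 0), (forall u v, C u -> C v -> C (u.1 + v.1, u.2 + v.2))
    & forall l u, 0 <= l -> C u -> C (l *: u.1, l * u.2)].

Lemma sublinear0 p : sublinear p -> p 0 = 0.
Proof.
move=> [pD pZ]; apply/eqP; rewrite eq_le; apply/andP; split.
  by have := pZ 0 0 (lexx _); rewrite scale0r mul0r.
by have := pD 0 0; rewrite addr0; lra.
Qed.

Lemma sublinearZ p l x : sublinear p -> 0 <= l -> p (l *: x) = l * p x.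
Proof.
move=> sp l0; have [_ pZ] := sp; apply/eqP; rewrite eq_le pZ//=.
have [->|ln0] := eqVneq l 0; first by rewrite scale0r mul0r sublinear0.
have lp : 0 < l by rewrite lt_neqAle eq_sym ln0.
have := pZ l^-1 (l *: x); rewrite invr_ge0 scalerA mulVf// scale1r => /(_ l0).
by rewrite -(ler_pM2l lp) mulrA divff// mul1r.
Qed.

Lemma sublinear_geN p x : sublinear p -> - p (- x) <= p x.
Proof.
by move=> sp; have := sp.1 x (- x); rewrite subrr (sublinear0 sp); lra.
Qed.

(** The largest sublinear functional below [p] that satisfies the constraints
    [q (- w) <= - c] for all [(w, c)] in the cone [C]. *)
Definition tilt p C z := inf [set p (z + u.1) - u.2 | u in C].

Section Tilt.
Variables (p : V -> R) (C : set (V * R)).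
Hypotheses (sp : sublinear p) (cC : convex_cone C).
Hypothesis Cp : forall u, C u -> u.2 <= p u.1.

Let tilt_lb z : lbound [set p (z + u.1) - u.2 | u in C] (- p (- z)).
Proof.
move=> _ [u Cu <-]; have := Cp Cu; have := sp.1 (z + u.1) (- z).
by rewrite addrAC subrr add0r; lra.
Qed.

Let tilt_has_inf z : has_inf [set p (z + u.1) - u.2 | u in C].
Proof.
by case: cC => C0 _ _; split; [exists (p (z + 0) - 0), (0, 0)|exists (- p (- z))].
Qed.

Lemma tilt_le z u : C u -> tilt p C z <= p (z + u.1) - u.2.
Proof. by move=> Cu; apply: ge_inf; [case: (tilt_has_inf z)|exists u]. Qed.

Lemma tilt_approx z e : 0 < e ->
  exists u, C u /\ p (z + u.1) - u.2 < tilt p C z + e.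
Proof.
by move=> e0; have [_ [u Cu <-] lt] := inf_adherent e0 (tilt_has_inf z); exists u.
Qed.

Lemma sublinear_tilt : sublinear (tilt p C).
Proof.
case: cC => C0 CD CZ; split=> [x y|l x l0].
  apply/ler_addgt0Pr => e e0; have e20 : 0 < e / 2 by lra.
  have [u [Cu ltu]] := tilt_approx x e20; have [v [Cv ltv]] := tilt_approx y e20.
  have := tilt_le (x + y) (CD _ _ Cu Cv); have := sp.1 (x + u.1) (y + v.1).
  by rewrite /= addrACA; lra.
apply/ler_addgt0Pr => e e0.
have [->|ln0] := eqVneq l 0.
  rewrite scale0r mul0r; have := tilt_le 0 C0.
  by rewrite /= addr0 (sublinear0 sp); lra.
have lp : 0 < l by rewrite lt_neqAle eq_sym ln0.
have el0 : 0 < e / l by rewrite divr_gt0.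
have [u [Cu ltu]] := tilt_approx x el0.
apply: (le_trans (tilt_le _ (CZ _ _ l0 Cu))).
rewrite /= -scalerDr sublinearZ// -mulrBr.
rewrite -(ltr_pM2l lp) [ltRHS]mulrDr [l * (e / l)]mulrC divfK// in ltu.
exact: ltW.
Qed.

End Tilt.

(** A sublinear functional that is minimal below [p]: along a chain the
    pointwise infimum is again sublinear. *)
Lemma exists_minimal_sublinear p : sublinear p ->
  exists2 q, sublinear q /\ (forall x, q x <= p x) &
    forall r, sublinear r -> (forall x, r x <= q x) -> r = q.
Proof.
move=> sp.
pose T := {q : V -> R | sublinear q /\ forall x, q x <= p x}.
pose Rl (s t : T) := `[< forall x, sval t x <= sval s x >].
have [|||F totF|t tmin] := @Zorn T Rl.
- by move=> t; apply/asboolP.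
- move=> r s t /asboolP rs /asboolP st; apply/asboolP => x.
  exact: le_trans (st x) (rs x).
- move=> [s Ps] [t Pt] /asboolP /= st /asboolP /= ts; apply: eq_exist.
  by apply/funext => x; apply/eqP; rewrite eq_le st ts.
- have [[t0 Ft0]|F0] := pselect (exists t, F t); last first.
    exists (exist _ p (conj sp (fun x => lexx (p x)))) => s Fs.
    by exfalso; apply: F0; exists s.
  pose W x := [set sval t x | t in F].
  have Wlb x : lbound (W x) (- p (- x)).
    move=> _ [[q [sq qp]] Fq <-] /=; apply: le_trans (sublinear_geN x sq).
    by rewrite lerN2.
  have Winf x : has_inf (W x).
    by split; [exists (sval t0 x), t0|exists (- p (- x))].
  pose r x := inf (W x).
  have r_le t x : F t -> r x <= sval t x.
    by move=> Ft; apply: ge_inf; [case: (Winf x)|exists t].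
  have r_app x e : 0 < e -> exists2 t, F t & sval t x < r x + e.
    by move=> e0; have [_ [t Ft <-] lt] := inf_adherent e0 (Winf x); exists t.
  have sr : sublinear r.
    split=> [x y|l x l0]; apply/ler_addgt0Pr => e e0.
      have e20 : 0 < e / 2 by lra.
      have [s Fs ss] := r_app x _ e20; have [t Ft tt] := r_app y _ e20.
      case: (totF s t Fs Ft) => /asboolP st.
        have := r_le t (x + y) Ft; have := (proj1 (svalP t)).1 x y.
        by have := st x; lra.
      have := r_le s (x + y) Fs; have := (proj1 (svalP s)).1 x y.
      by have := st y; lra.
    have [->|ln0] := eqVneq l 0.
      rewrite scale0r mul0r; apply: (le_trans (r_le _ _ Ft0)).
      by rewrite (sublinear0 (proj1 (svalP t0))); lra.
    have lp : 0 < l by rewrite lt_neqAle eq_sym ln0.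
    have el0 : 0 < e / l by rewrite divr_gt0.
    have [s Fs ss] := r_app x _ el0.
    apply: (le_trans (r_le _ _ Fs)); rewrite (sublinearZ _ (proj1 (svalP s)))//.
    by rewrite -(ltr_pM2l lp) [ltRHS]mulrDr [l * (e / l)]mulrC divfK// in ss; exact: ltW.
  have rp x : r x <= p x by exact: le_trans (r_le t0 x Ft0) ((svalP t0).2 x).
  exists (exist _ r (conj sr rp)) => s Fs; apply/asboolP => x; exact: r_le.
- exists (sval t) => [|r sr rt]; first exact: (svalP t).
  have rp x : r x <= p x by exact: le_trans (rt x) ((svalP t).2 x).
  by rewrite -(tmin (exist _ r (conj sr rp)))//; apply/asboolP.
Qed.

(** Tilting a minimal [q] along the half-line through [y] cannot decrease it,
    so [q z <= q (z + y) - q y]; a superadditive sublinear map is linear. *)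
Lemma minimal_sublinear_linear q : sublinear q ->
  (forall r, sublinear r -> (forall x, r x <= q x) -> r = q) ->
  (forall x y, q (x + y) = q x + q y) /\ (forall l x, q (l *: x) = l * q x).
Proof.
move=> sq qmin.
have qD x y : q (x + y) = q x + q y.
  pose C : set (V * R) := [set u | exists2 l, 0 <= l & u = (l *: y, l * q y)].
  have cC : convex_cone C.
    split; first by exists 0; rewrite // scale0r mul0r.
      move=> _ _ [l l0 ->] [m m0 ->]; exists (l + m); first exact: addr_ge0.
      by rewrite /= scalerDl mulrDl.
    move=> l _ l0 [m m0 ->]; exists (l * m); first exact: mulr_ge0.
    by rewrite /= scalerA mulrA.
  have Cq u : C u -> u.2 <= q u.1 by move=> [l l0 ->] /=; rewrite sublinearZ.
  have C0 : C (0, 0) by case: cC.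
  have tq : tilt q C = q.
    apply: qmin => [|z]; first exact: sublinear_tilt.
    by have := tilt_le sq cC Cq z C0; rewrite /= addr0 subr0.
  have Cy : C (y, q y) by exists 1; rewrite ?scale1r ?mul1r.
  have := tilt_le sq cC Cq x Cy; rewrite tq /=; have := sq.1 x y.
  by move=> ? ?; apply/eqP; rewrite eq_le; apply/andP; split; lra.
have qN x : q (- x) = - q x.
  by apply/eqP; rewrite -addr_eq0 -qD addNr (sublinear0 sq).
split=> // l x; have [l0|l0] := leP 0 l; first exact: sublinearZ.
by rewrite -[l]opprK scaleNr qN sublinearZ ?mulNr// oppr_ge0 ltW.
Qed.

(** Theorem of Mazur and Orlicz: a minimal sublinear functional below the
    tilted [p] is linear, and its value at [- w] gives the bound at [w]. *)
Lemma mazur_orlicz p C : sublinear p -> convex_cone C ->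
  (forall u, C u -> u.2 <= p u.1) ->
  exists f : V -> R, [/\ (forall x y, f (x + y) = f x + f y),
    (forall l x, f (l *: x) = l * f x), (forall x, f x <= p x)
    & forall u, C u -> u.2 <= f u.1].
Proof.
move=> sp cC Cp.
have [q [sq qle] qmin] := exists_minimal_sublinear (sublinear_tilt sp cC Cp).
have [qD qZ] := minimal_sublinear_linear sq qmin.
have C0 : C (0, 0) by case: cC.
exists q; split=> // [x|u Cu].
  apply: (le_trans (qle x)).
  by have := tilt_le sp cC Cp x C0; rewrite /= addr0 subr0.
have := le_trans (qle (- u.1)) (tilt_le sp cC Cp (- u.1) Cu).
by rewrite addNr (sublinear0 sp) -scaleN1r qZ; lra.
Qed.

End MazurOrlicz.

(** * Complex normed spaces *)

(** A complex vector space with its scalars restricted to the reals. *)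
Definition real_lmod (R : realType) (V : lmodType R[i]) : Type := V.

Section RealLmod.
Variables (R : realType) (V : lmodType R[i]).

HB.instance Definition _ := GRing.Zmodule.on (real_lmod V).

Let rscale (r : R) (x : real_lmod V) : real_lmod V := r%:C *: (x : V).

Let rscaleA a b x : rscale a (rscale b x) = rscale (a * b) x.
Proof. by rewrite /rscale scalerA -rmorphM. Qed.

Let rscale1 : left_id 1 rscale. Proof. by move=> x; exact: scale1r. Qed.

Let rscaleDr : right_distributive rscale +%R.
Proof. by move=> a x y; exact: scalerDr. Qed.

Let rscaleDl x : {morph rscale^~ x : a b / a + b}.
Proof. by move=> a b; rewrite /rscale rmorphD scalerDl. Qed.

HB.instance Definition _ := GRing.Zmodule_isLmodule.Build R (real_lmod V)
  rscaleA rscale1 rscaleDr rscaleDl.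

Lemma real_lmodZ (r : R) (x : V) : r *: (x : real_lmod V) = r%:C *: x.
Proof. by []. Qed.

End RealLmod.

Section RealNorm.
Variable R : realType.
Implicit Types V W : normedModType R[i].

(** The norm of a complex normed space takes values in [R[i]]; estimates are
    made on its real part. *)
Definition rnorm V (x : V) : R := complex.Re `|x|.

Lemma rnormE V (x : V) : `|x| = (rnorm x)%:C.
Proof. by rewrite RRe_real// ger0_real. Qed.

Lemma rnorm_ge0 V (x : V) : 0 <= rnorm x.
Proof. by rewrite -ler0c -rnormE. Qed.

Lemma rnormD V (x y : V) : rnorm (x + y) <= rnorm x + rnorm y.
Proof. by rewrite -lecR rmorphD/= -!rnormE ler_normD. Qed.

Lemma rnormN V (x : V) : rnorm (- x) = rnorm x.
Proof. by rewrite /rnorm normrN. Qed.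

Lemma rnorm_distC V (x y : V) : rnorm (x - y) = rnorm (y - x).
Proof. by rewrite /rnorm distrC. Qed.

Lemma rnorm0 V : rnorm (0 : V) = 0.
Proof. by rewrite /rnorm normr0. Qed.

Lemma rnorm0_eq0 V (x : V) : rnorm x = 0 -> x = 0.
Proof. by move=> x0; apply/eqP; rewrite -normr_eq0 rnormE x0. Qed.

Lemma rnormZ V (c : R[i]) (x : V) :
  rnorm (c *: x) = rnorm (c : R[i]^o) * rnorm x.
Proof. by apply: complexI; rewrite rmorphM/= -!rnormE normrZ. Qed.

Lemma rnormC (r : R) : rnorm (r%:C : R[i]^o) = `|r|.
Proof. by rewrite /rnorm normc_def/= expr0n addr0 sqrtr_sqr. Qed.

Lemma rnormZr V (r : R) (x : V) : 0 <= r -> rnorm (r%:C *: x) = r * rnorm x.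
Proof. by move=> r0; rewrite rnormZ rnormC ger0_norm. Qed.

Lemma rnormMn V (x : V) n : rnorm (x *+ n) = rnorm x *+ n.
Proof.
by rewrite -scaler_nat -(rmorph_nat (real_complex R)) rnormZr// mulr_natl.
Qed.

Lemma rnorm_sum V (F : nat -> V) m n :
  rnorm (\sum_(m <= j < n) F j) <= \sum_(m <= j < n) rnorm (F j).
Proof.
elim/big_ind2: _ => [|x1 x2 y1 y2 h1 h2|//]; first by rewrite rnorm0.
by rewrite (le_trans (rnormD _ _))// lerD.
Qed.

Lemma rnormi : rnorm ('i%C : R[i]^o) = 1.
Proof. by rewrite /rnorm normc_def/= expr0n add0r expr1n sqrtr1. Qed.

Lemma rnorm_iX k : rnorm ('i%C ^+ k : R[i]^o) = 1.
Proof.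
elim: k => [|k IH]; first by rewrite /rnorm expr0 normr1.
by rewrite exprS -['i%C * _]/('i%C *: (_ : R[i]^o)) rnormZ rnormi mul1r.
Qed.

Lemma Re_le_rnorm (z : R[i]^o) : complex.Re z <= rnorm z.
Proof.
by apply: le_trans (ler_norm _) _; rewrite -lecR -rnormE; exact: normc_ge_Re.
Qed.

Lemma exists_rotation (z : R[i]^o) :
  exists2 c : R[i], rnorm (c : R[i]^o) = 1 & c * z = (rnorm z)%:C.
Proof.
have [->|z0] := eqVneq z 0; first by exists 1; rewrite ?rnorm0 ?mulr0// /rnorm normr1.
exists (`|z| / z); last by rewrite divfK// rnormE.
by rewrite /rnorm normrM normr_id normfV divff ?normr_eq0.
Qed.

Lemma cont_dualP V (f : V -> R[i]^o) : cont_dual V f <->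
  linear f /\ exists M, forall x, rnorm (f x) <= M * rnorm x.
Proof.
split=> -[lf]; (pose L := GRing.isLinear.Build _ _ _ _ f lf);
    pose g : {linear V -> R[i]^o} := HB.pack f L; rewrite -[f]/(g : V -> _).
  move=> /linear_bounded_continuous/linear_boundedP/pinfty_ex_gt0[M M0 fM].
  split=> //; exists (complex.Re M) => x.
  have MR : M = (complex.Re M)%:C by rewrite RRe_real// gtr0_real.
  by rewrite -lecR rmorphM/= -MR -!rnormE.
move=> [M fM]; split=> //; apply/linear_bounded_continuous/linear_boundedP.
exists M%:C; split; first by rewrite complex_real.
by move=> r /ltW Mr x; rewrite (le_trans _ (ler_wpM2r (normr_ge0 _) Mr))//
  !rnormE -rmorphM lecR.
Qed.

(** A real-linear [f] is the real part of the complex-linear functional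
    [x |-> f x - i f (i x)]. *)
Lemma complexify V (f : V -> R) : (forall x y, f (x + y) = f x + f y) ->
    (forall (r : R) x, f (r%:C *: x) = r * f x) ->
    (forall x, f x <= rnorm x) ->
  exists2 g, cont_dual V g & forall x, complex.Re (g x) = f x.
Proof.
move=> fD fZ f_le; exists (fun x => f x +i* - f ('i%C *: x)) => //.
have fN x : f (- x) = - f x.
  by rewrite -scaleN1r -(rmorph1 (real_complex R)) -rmorphN fZ mulN1r.
apply/cont_dualP; split.
  have fi z : f ('i%C *: ('i%C *: z)) = - f z.
    by rewrite scalerA -expr2 sqr_i scaleN1r fN.
  have fC c z : f (c *: z) = complex.Re c * f z + complex.Im c * f ('i%C *: z).
    by rewrite {1}[c]complexE scalerDl fD ['i%C * _]mulrC -scalerA !fZ.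
  move=> c x y; rewrite scalerDr scalerA mulrC -scalerA !fD !(fC c) fi.
  case: c => a b; apply/eqP; rewrite eq_complex/=.
  by apply/andP; split; apply/eqP; ring.
exists 2 => x.
have f_abs y : `|f y| <= rnorm y by rewrite ler_norml f_le andbT lerNl -fN -(rnormN y).
rewrite [X in rnorm X]complexE/= (le_trans (rnormD _ _))// mulr_natl mulr2n.
apply: lerD; first by rewrite rnormC.
by rewrite -['i%C * _]/('i%C *: (_ : R[i]^o)) rnormZ rnormi mul1r rnormC normrN
  (le_trans (f_abs _))// rnormZ rnormi mul1r.
Qed.

(** Separation of a point from a convex set at distance [e], by the theorem of
    Mazur and Orlicz for the norm and the cone spanned by the pairs [(x - y, e)]. *)
Lemma separation V (S : set V) (x : V) (e : R) : S !=set0 ->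
    (forall (t : R) y z, 0 <= t <= 1 -> S y -> S z ->
       S (t%:C *: y + (1 - t)%:C *: z)) ->
    (forall y, S y -> e <= rnorm (x - y)) ->
  exists g, [/\ cont_dual V g, (forall z, complex.Re (g z) <= rnorm z)
    & forall y, S y -> complex.Re (g y) + e <= complex.Re (g x)].
Proof.
move=> [y0 Sy0] Sconv Sfar.
pose p (z : real_lmod V) := rnorm (z : V).
have sp : sublinear p.
  split=> [y z|l y l0]; first exact: rnormD.
  by rewrite /p real_lmodZ rnormZr.
pose C : set (real_lmod V * R) := [set u | exists l y,
  [/\ 0 <= l, S y & u = (l *: (x - y : real_lmod V), l * e)]].
have cC : convex_cone C.
  split.
  - by exists 0, y0; rewrite lexx scale0r mul0r.
  - move=> _ _ [l [y [l0 Sy ->]]] [m [z [m0 Sz ->]]] /=.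
    have [lm0|lmn0] := eqVneq (l + m) 0.
      have /andP[/eqP -> /eqP ->] : (l == 0) && (m == 0) by rewrite -paddr_eq0 ?lm0.
      by exists 0, y0; rewrite lexx !scale0r !mul0r !addr0.
    have lm : 0 < l + m by rewrite lt_neqAle eq_sym lmn0 addr_ge0.
    pose t := l / (l + m).
    exists (l + m), (t%:C *: y + (1 - t)%:C *: z); split; [exact: ltW| |].
      apply: Sconv => //; rewrite divr_ge0 ?addr_ge0// ler_pdivrMr// mul1r.
      by rewrite lerDl.
    have lt : (l + m) * t = l by rewrite mulrC divfK.
    have mt : (l + m) * (1 - t) = m by rewrite mulrBr lt mulr1 addrAC subrr add0r.
    have xyz : x - (t%:C *: y + (1 - t)%:C *: z)
             = t%:C *: (x - y) + (1 - t)%:C *: (x - z).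
      rewrite !scalerBr addrACA -scalerDl -rmorphD addrC.
      by rewrite [t + _]addrC subrK rmorph1 scale1r opprD addrC.
    have lmxyz : (l + m)%:C *: (x - (t%:C *: y + (1 - t)%:C *: z))
               = l%:C *: (x - y) + m%:C *: (x - z).
      by rewrite xyz scalerDr !scalerA -!rmorphM lt mt.
    by rewrite mulrDl; congr (_, _); exact: esym lmxyz.
  - move=> l _ l0 [m [z [m0 Sz ->]]] /=; exists (l * m), z.
    by rewrite mulr_ge0// scalerA mulrA.
have Cp u : C u -> u.2 <= p u.1.
  move=> [l [y [l0 Sy ->]]] /=; rewrite /p real_lmodZ rnormZr//.
  by rewrite ler_wpM2l// Sfar.
have [f [fD fZ fp fC]] := mazur_orlicz sp cC Cp.
have [g cg gf] := complexify fD fZ fp.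
exists g; split=> // [z|y Sy]; first by rewrite gf; exact: fp.
have : C (x - y, e) by exists 1, y; rewrite scale1r mul1r.
have fN z : f (- z) = - f z by rewrite -scaleN1r fZ mulN1r.
by move=> /fC /=; rewrite (fD x (- (y : real_lmod V))) fN !gf; lra.
Qed.

Lemma geometric_small (M q e : R) : 0 <= q < 1 -> 0 < e ->
  \forall n \near \oo, M * q ^+ n < e.
Proof.
move=> /andP[q0 q1] e0; have : (fun n => M * q ^+ n) @ \oo --> M * 0.
  by apply: cvgMr; apply: cvg_expr; rewrite ger0_norm.
rewrite mulr0 => /cvgrPdist_lt/(_ _ e0); apply: filterS => n.
rewrite sub0r normrN; exact/le_lt_trans/ler_norm.
Qed.

(** Geometrically fast Cauchy sequences converge, with an explicit rate. *)
Lemma geometric_limit (V : completeNormedModType R[i]) (u : nat -> V) (M q : R) :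
    0 <= q < 1 -> (forall n, rnorm (u n.+1 - u n) <= M * q ^+ n) ->
  exists l, forall n, rnorm (u n - l) <= M * q ^+ n / (1 - q).
Proof.
move=> /andP[q0 q1] uq.
have q10 : 0 < 1 - q by lra.
have M0 : 0 <= M.
  by have := le_trans (rnorm_ge0 _) (uq 0); rewrite expr0 mulr1.
have umn n k : rnorm (u n - u (n + k)%N) <= M * q ^+ n / (1 - q).
  suff : rnorm (u n - u (n + k)%N) <= M * q ^+ n * (1 - q ^+ k) / (1 - q).
    move=> /le_trans; apply; rewrite ler_wpM2r ?invr_ge0 ?(ltW q10)//.
    rewrite ler_piMr ?mulr_ge0 ?exprn_ge0//.
    by rewrite lerBlDr lerDl exprn_ge0.
  elim: k => [|k IH]; first by rewrite addn0 subrr rnorm0 expr0 subrr mulr0 mul0r.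
  have -> : u n - u (n + k.+1)%N =
      (u n - u (n + k)%N) + (u (n + k)%N - u (n + k).+1).
    by rewrite addnS addrA subrK.
  apply: (le_trans (rnormD _ _)); rewrite [X in _ + X]rnorm_distC.
  apply: (le_trans (lerD IH (uq _))).
  rewrite exprD exprS le_eqVlt; apply/orP; left; apply/eqP.
  by field; rewrite gt_eqF.
have ucvg : cvgn u.
  apply/cauchy_cvgP/cauchy_exP => e e0.
  have eR : e = (complex.Re e)%:C by rewrite RRe_real// gtr0_real.
  have Re0 : 0 < complex.Re e by rewrite -ltcR -eR.
  have q01 : 0 <= q < 1 by rewrite q0.
  have [N _ /(_ N (leqnn N)) /=] := geometric_small (M / (1 - q)) q01 Re0.
  rewrite mulrAC => HN.
  exists (u N); exists N => // m /= Nm; rewrite -ball_normE /=.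
  rewrite rnormE eR ltcR; apply: le_lt_trans HN.
  by rewrite -(subnKC Nm).
exists (limn u) => n; apply/ler_addgt0Pr => e e0.
have eC : 0 < e%:C by rewrite ltcR.
have /cvgrPdist_lt/(_ _ eC)[N _ HN] := ucvg.
have /HN : (N <= n + N)%N by rewrite leq_addl.
rewrite /= rnormE ltcR rnorm_distC => H.
have -> : u n - limn u = (u n - u (n + N)%N) + (u (n + N)%N - limn u).
  by rewrite addrA subrK.
by apply: (le_trans (rnormD _ _)); apply: lerD (umn _ _) (ltW H).
Qed.

End RealNorm.

(** * Growth of powers in a Banach algebra *)

Section ExponentialTail.
Variable R : realType.
Implicit Types r x : R.

Lemma binomial_le_exp_term n j r : (0 < n)%N -> 0 <= r ->
  (r / n%:R) ^+ j *+ 'C(n, j) <= r ^+ j / j`!%:R.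
Proof.
move=> n0 r0.
have nR : 0 < n%:R ^+ j :> R by rewrite exprn_gt0// ltr0n.
have jR : 0 < j`!%:R :> R by rewrite ltr0n fact_gt0.
rewrite expr_div_n -mulr_natr -mulrA ler_wpM2l ?exprn_ge0//.
rewrite ler_pdivrMl// ler_pdivlMr// -natrX -natrM ler_nat bin_ffact ffact_prod.
rewrite -[in leqRHS](card_ord j) -prod_nat_const.
by apply: leq_prod => i _; exact: leq_subr.
Qed.

Lemma exp_tail m k r : 0 <= r <= m.+1%:R / 2 ->
  \sum_(m <= j < m + k) r ^+ j / j`!%:R <= 2 * (r ^+ m / m`!%:R).
Proof.
elim: k m => [|k IH] m /andP[r0 rm].
  by rewrite addn0 big_geq// mulr_ge0// divr_ge0// exprn_ge0.
rewrite addnS big_ltn ?ltnS ?leq_addr// -addSn.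
have mR : 0 < m.+1%:R :> R by rewrite ltr0n.
have IHm := IH m.+1; rewrite r0 (le_trans rm) ?ler_pM2r ?ler_nat// in IHm.
apply: (le_trans (lerD (lexx _) (IHm isT))).
rewrite factS natrM exprS invfM.
set a := r ^+ m; set b := (_`!%:R)^-1.
have ab : 0 <= a * b by rewrite mulr_ge0 ?invr_ge0 ?exprn_ge0.
have q : r / m.+1%:R <= 1 / 2 by rewrite ler_pdivrMr//; lra.
have -> : r * a * (m.+1%:R^-1 * b) = (r / m.+1%:R) * (a * b) by ring.
move: (a * b) (r / _) ab q => c t c0 t2.
by have := ler_wpM2r c0 t2; lra.
Qed.

Lemma expR_le1D2x x : 0 <= x <= 1 / 2 -> expR x <= 1 + 2 * x.
Proof.
move=> /andP[x0 x2]; have eN := expR_ge1Dx (- x); have e0 := expR_gt0 x.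
have h1 : expR x * (1 - x) <= 1 by rewrite -[leRHS](expRxMexpNx_1 x) ler_pM2l.
have h2 : 1 <= (1 + 2 * x) * (1 - x).
  have -> : (1 + 2 * x) * (1 - x) = 1 + x * (1 - 2 * x) by ring.
  by rewrite lerDl mulr_ge0//; lra.
have x1 : 0 < 1 - x by lra.
by rewrite -(ler_pM2r x1); exact: le_trans h1 h2.
Qed.

Lemma expR_le1Dxx x : x <= 1 / 2 -> expR x <= 1 + x + 2 * x ^+ 2.
Proof.
move=> x2; have eN := expR_ge1Dx (- x); have e0 := expR_gt0 x.
have h1 : expR x * (1 - x) <= 1 by rewrite -[leRHS](expRxMexpNx_1 x) ler_pM2l.
have h2 : 1 <= (1 + x + 2 * x ^+ 2) * (1 - x).
  have -> : (1 + x + 2 * x ^+ 2) * (1 - x) = 1 + x ^+ 2 * (1 - 2 * x) by ring.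
  by rewrite lerDl mulr_ge0 ?sqr_ge0//; lra.
have x1 : 0 < 1 - x by lra.
by rewrite -(ler_pM2r x1); exact: le_trans h1 h2.
Qed.

End ExponentialTail.

(** The algebra structure of a Banach algebra, on a copy of its type. *)
Definition balg_ring (R : realType) (A : banachAlgType R[i]) : Type := A.

Section BalgRing.
Variables (R : realType) (A : banachAlgType R[i]).

HB.instance Definition _ := GRing.Lmodule.on (balg_ring A).

HB.instance Definition _ := GRing.Zmodule_isPzRing.Build (balg_ring A)
  (@balg_mulA _ A) (@balg_mul1r _ A) (@balg_mulr1 _ A)
  (@balg_mulDl _ A) (@balg_mulDr _ A).

Lemma balg_exprZ (c : R[i]) (x : balg_ring A) n :
  (c *: x) ^+ n = c ^+ n *: x ^+ n.
Proof.
elim: n => [|n IH]; first by rewrite !expr0 scale1r.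
rewrite !exprS IH -scalerA.
rewrite -[RHS]/(c *: (c ^+ n *: balg_mul (x : A) (x ^+ n : balg_ring A))).
by rewrite balg_scaleAr balg_scaleAl.
Qed.

Lemma rnormM (x y : balg_ring A) : rnorm (x * y : A) <= rnorm (x : A) * rnorm (y : A).
Proof. by rewrite -lecR rmorphM/= -!rnormE; exact: balg_normM. Qed.

Hypothesis norm1 : `|balg_one A| = 1.

Lemma rnorm1 : rnorm (1 : balg_ring A) = 1.
Proof. by rewrite /rnorm norm1. Qed.

Lemma rnormX (x : balg_ring A) n : rnorm (x ^+ n : A) <= rnorm (x : A) ^+ n.
Proof.
elim: n => [|n IH]; first by rewrite !expr0 rnorm1.
rewrite !exprS (le_trans (rnormM _ _))// ler_wpM2l//; exact: rnorm_ge0.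
Qed.

(** The coefficients [C(n, j) (r/n)^j] are at most [r^j / j!], uniformly in [n],
    and beyond degree [m] these decrease at least by half at each step. *)
Lemma binomial_tail (d : nat -> R[i]) (u : balg_ring A) n m (r : R) :
    (forall j, rnorm (d j : R[i]^o) <= 1) -> (0 < n)%N ->
    0 <= r <= m.+1%:R / 2 -> rnorm (u : A) <= r / n%:R -> (m <= n.+1)%N ->
  rnorm (\sum_(m <= j < n.+1) d j *: (u ^+ j *+ 'C(n, j)) : A)
    <= 2 * (r ^+ m / m`!%:R).
Proof.
move=> d1 n0 rm un mn; apply: (le_trans (rnorm_sum _ _ _)).
rewrite -(subnKC mn); apply: le_trans (exp_tail (n.+1 - m) rm).
apply: ler_sum => j _; rewrite rnormZ -[leRHS]mul1r.
apply: ler_pM; rewrite ?rnorm_ge0//; apply: le_trans (binomial_le_exp_term _ n0 _).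
  rewrite rnormMn lerMn2r (le_trans (rnormX _ _)) ?orbT//.
  by rewrite lerXn2r// ?nnegrE ?rnorm_ge0 ?(le_trans (rnorm_ge0 _) un).
by case/andP: rm.
Qed.

(** First-order growth of the norm at the unit in the direction [a]. The infimum
    of the admissible [m] is the maximum of the real part of the numerical range
    of [a]. *)
Definition unit_growth (a : balg_ring A) (m : R) :=
  exists2 s0, 0 < s0 &
    forall s, 0 < s <= s0 -> rnorm (s%:C *: a + 1 : balg_ring A) <= 1 + s * m.

Lemma unit_growthZ a m (c : R) : 0 < c ->
  unit_growth a m -> unit_growth (c%:C *: a) (c * m).
Proof.
move=> c0 [s0 s00 H]; exists (s0 / c); first exact: divr_gt0.
move=> s /andP[sp ss]; rewrite scalerA -rmorphM mulrA; apply: H.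
by rewrite mulr_gt0//= -ler_pdivlMr.
Qed.

(** The Euler approximations of [exp (t a)] inherit the first-order growth
    along the ray through [a]. *)
Lemma unit_growth_euler a m t : unit_growth a m -> 0 <= t ->
  exists N, forall n, (N <= n)%N -> (0 < n)%N ->
    rnorm (((t / n%:R)%:C *: a + 1) ^+ n : balg_ring A) <= expR (t * m).
Proof.
move=> [s0 s00 H] t0; have [t00|tn0] := eqVneq t 0.
  exists 0 => n _ _; rewrite t00 !mul0r rmorph0 scale0r add0r expr1n expR0.
  by rewrite rnorm1.
have tp : 0 < t by rewrite lt_neqAle eq_sym tn0.
exists (Num.bound (t / s0)) => n Nn n0.
have nR : 0 < n%:R :> R by rewrite ltr0n.
apply: (le_trans (rnormX _ _)).
have -> : t * m = n%:R * (t / n%:R * m).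
  by rewrite mulrA [n%:R * _]mulrC divfK// gt_eqF.
rewrite expRM_natl lerXn2r// ?nnegrE ?rnorm_ge0 ?expR_ge0//.
apply: le_trans (expR_ge1Dx _); apply: H; rewrite divr_gt0//=.
rewrite ler_pdivrMr// -ler_pdivrMl// mulrC.
have ts : `|t / s0| = t / s0 by rewrite ger0_norm// divr_ge0// ltW.
rewrite -ts (le_trans (ltW (archi_boundP (normr_ge0 _))))//.
by rewrite ler_nat ts.
Qed.

(** Expanding the Euler approximations: their terms of degree zero and one are
    those of [1 + t a], and [exp (t m)] and the remaining terms contribute at
    most quadratically, with constants that do not depend on [a]. *)
Lemma unit_growth_quadratic a m t : unit_growth a m -> rnorm (a : A) <= 1 ->
    `|m| <= 1 -> 0 <= t <= 1 / 2 ->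
  rnorm (t%:C *: a + 1 : balg_ring A) <= 1 + t * m + 3 * t ^+ 2.
Proof.
move=> ga a1 m1 /andP[t0 t2]; have [N HN] := unit_growth_euler ga t0.
pose n := N.+1; have nR : 0 < n%:R :> R by rewrite ltr0n.
set u : balg_ring A := (t / n%:R)%:C *: a.
have un : rnorm (u : A) <= t / n%:R.
  by rewrite rnormZr ?divr_ge0// ler_piMr// divr_ge0.
have E : (u + 1) ^+ n = t%:C *: a + 1 +
    \sum_(2 <= j < n.+1) (1 : R[i]) *: (u ^+ j *+ 'C(n, j)).
  rewrite exprD1n -(big_mkord predT (fun j => u ^+ j *+ 'C(n, j))).
  rewrite big_ltn// big_ltn ?ltnS// addrA; congr (_ + _); last first.
    by apply: eq_bigr => j _; rewrite scale1r.
  rewrite bin0 bin1 expr0 expr1 mulr1n addrC; congr (_ + _).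
  rewrite /u -scaler_nat scalerA -(rmorph_nat (real_complex R)) -rmorphM.
  by rewrite mulrC divfK// gt_eqF.
have t32 : 0 <= t <= 3%:R / 2 by rewrite t0/=; lra.
have one1 : forall j : nat, rnorm (1 : R[i]^o) <= 1.
  by move=> _; rewrite /rnorm normr1.
have T := binomial_tail one1 (ltn0Sn N) t32 un isT.
have -> : t%:C *: a + 1 = (u + 1) ^+ n -
    \sum_(2 <= j < n.+1) (1 : R[i]) *: (u ^+ j *+ 'C(n, j)) by rewrite E addrK.
apply: (le_trans (rnormD _ _)); rewrite rnormN.
apply: le_trans (lerD (HN n (leqnSn _) isT) T) _.
have tm2 : t * m <= 1 / 2.
  rewrite (le_trans (ler_norm _))// normrM (ger0_norm t0).
  by rewrite -[leRHS]mulr1 ler_pM.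
have h1 := expR_le1Dxx tm2.
have h2 : (t * m) ^+ 2 <= t ^+ 2.
  by rewrite exprMn ler_piMr ?sqr_ge0// -(real_normK (num_real m)) exprn_ile1.
have -> : 2`!%:R = 2 :> R by [].
clear - h1 h2; lra.
Qed.

Lemma sum_fourth_roots j : (j < 5)%N ->
  \sum_(0 <= k < 4) 'i%C ^+ (3 * k) * 'i%C ^+ k ^+ j = (4 * (j == 1)%:R)%:C :> R[i].
Proof.
move=> j5; have i2 : 'i%C ^+ 2 = - 1 :> R[i] by exact: sqr_i.
have i3 : 'i%C ^+ 3 = - 'i%C :> R[i] by rewrite exprS i2 mulrN1.
have i4 : 'i%C ^+ 4 = 1 :> R[i] by rewrite exprS i3 mulrN -expr2 i2 opprK.
have iX n : 'i%C ^+ n = [:: 1; 'i%C; - 1; - 'i%C]`_(n %% 4) :> R[i].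
  rewrite {1}(divn_eq n 4) exprD mulnC exprM i4 expr1n mul1r.
  by case: (n %% 4)%N (ltn_pmod n (isT : 0 < 4)%N) => [|[|[|[|]]]].
under eq_bigr => k _ do rewrite -exprM -exprD iX.
rewrite 4?big_nat_recr//= big_geq//.
case: j j5 => [|[|[|[|[|//]]]]] _; rewrite ?muln0 ?addn0 ?muln1 /=.
all: apply/eqP; rewrite eq_complex /=; apply/andP; split; apply/eqP; ring.
Qed.

Lemma sum_fourth_roots_le j :
  rnorm (\sum_(0 <= k < 4) 'i%C ^+ (3 * k) * 'i%C ^+ k ^+ j : R[i]^o) <= 4.
Proof.
apply: (le_trans (rnorm_sum _ _ _)).
rewrite (eq_bigr (fun=> 1)) => [|k _]; last by rewrite -exprM -exprD rnorm_iX.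
by rewrite sumr_const_nat.
Qed.

(** Averaging the powers [(1 + i^k u)^n] against the fourth roots of unity
    isolates the linear term [n u]: no other term of degree less than five
    survives. *)
Lemma roots_of_unity_average (u : balg_ring A) n : (3 < n)%N ->
  \sum_(0 <= k < 4) 'i%C ^+ (3 * k) *: ('i%C ^+ k *: u + 1) ^+ n =
  4%:C *: (u *+ n + \sum_(5 <= j < n.+1)
   (4^-1%:C * \sum_(0 <= k < 4) 'i%C ^+ (3 * k) * 'i%C ^+ k ^+ j) *:
      (u ^+ j *+ 'C(n, j))).
Proof.
move=> n3; pose c j : R[i] := \sum_(0 <= k < 4) 'i%C ^+ (3 * k) * 'i%C ^+ k ^+ j.
transitivity (\sum_(0 <= j < n.+1) c j *: (u ^+ j *+ 'C(n, j))).
  transitivity (\sum_(0 <= k < 4) \sum_(0 <= j < n.+1)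
      ('i%C ^+ (3 * k) * 'i%C ^+ k ^+ j) *: (u ^+ j *+ 'C(n, j))).
    apply: eq_bigr => k _; rewrite exprD1n big_mkord scaler_sumr.
    by apply: eq_bigr => j _; rewrite balg_exprZ scalerMnr scalerA.
  by rewrite exchange_big; apply: eq_bigr => j _; rewrite /= -scaler_suml.
have cE j : (j < 5)%N -> c j = (4 * (j == 1)%:R)%:C by exact: sum_fourth_roots.
have C0 : 4^-1%:C * 4%:C = 1 :> R[i] by rewrite -rmorphM mulVf.
rewrite (@big_cat_nat _ _ _ 5)//= scalerDr; congr (_ + _).
  rewrite 5?big_nat_recr//= big_geq// !cE// !mulr0 !scale0r !add0r !addr0.
  by rewrite mulr1 expr1 bin1.
rewrite scaler_sumr; apply: eq_bigr => j _.
by rewrite scalerA -/(c j) mulrA [4%:C * _]mulrC C0 mul1r.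
Qed.

(** A lower bound for the numerical radius. For [|a| = 1] the linear term in the
    average of the Euler approximations of [exp (i^k r a)] has norm [r], while
    the four exponentials are controlled by the growth constants; the value
    [r = 3/2] is large enough for the linear term to win. *)
Lemma numerical_radius (a : balg_ring A) (m : nat -> R) :
    (forall k, (k < 4)%N -> 0 <= m k /\ unit_growth ('i%C ^+ k *: a) (m k)) ->
  rnorm (a : A) <= 3 * \sum_(0 <= k < 4) m k.
Proof.
move=> H.
wlog a1 : a m H / rnorm (a : A) = 1.
  move=> W; have [a0|an0] := eqVneq (rnorm (a : A)) 0.
    rewrite a0 mulr_ge0// big_nat_cond sumr_ge0// => k /andP[/andP[_ k4] _].
    by have [] := H k k4.
  have ap : 0 < rnorm (a : A) by rewrite lt_neqAle eq_sym an0 rnorm_ge0.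
  set c := (rnorm (a : A))^-1; have cp : 0 < c by rewrite invr_gt0.
  have := W (c%:C *: a) (fun k => c * m k) _ _.
  rewrite rnormZr ?(ltW cp)// -mulr_sumr mulrCA ler_pM2l//; apply.
    move=> k k4; have [m0 g] := H k k4; split; first by rewrite mulr_ge0// ltW.
    by rewrite scalerA mulrC -scalerA; exact: unit_growthZ.
  by rewrite mulVf.
rewrite a1 -ler_pdivrMl// mulr1.
set P := \sum_(0 <= k < 4) m k.
rewrite leNgt; apply/negP => P3.
(* If the sum of the m k is less than 1/3, then r m k <= 1/2, which allows the
   linear bound on the exponentials; the average of the four powers then has
   norm at most 1 + r/6, the tail is at most r^5/60, and both together stay
   below r. *)
pose r : R := 3 / 2.
have r0 : 0 <= r by rewrite divr_ge0.
have mP k : (k < 4)%N -> m k <= P.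
  move=> k4; rewrite /P (bigD1_seq k) ?mem_index_iota ?iota_uniq//= lerDl.
  rewrite big_seq_cond sumr_ge0// => j; rewrite mem_index_iota => /andP[/andP[_ j4] _].
  by have [] := H j j4.
have [N HN] : exists N, forall n, (N <= n)%N -> (0 < n)%N -> forall k, (k < 4)%N ->
    rnorm (((r / n%:R)%:C *: ('i%C ^+ k *: a) + 1) ^+ n : balg_ring A)
      <= expR (r * m k).
  have euler k : exists N, (k < 4)%N -> forall n, (N <= n)%N -> (0 < n)%N ->
      rnorm (((r / n%:R)%:C *: ('i%C ^+ k *: a) + 1) ^+ n : balg_ring A)
        <= expR (r * m k).
    have [k4|] := ltnP k 4; last by exists 0.
    by have [N HN] := unit_growth_euler (H k k4).2 r0; exists N.
  have [f Hf] := choice euler.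
  exists (\max_(k < 4) f k) => n Nn n0 k k4; apply: Hf => //.
  by apply: leq_trans Nn; rewrite (leq_bigmax (Ordinal k4)).
have [n Nn n3] : exists2 n, (N <= n)%N & (3 < n)%N.
  by exists (maxn N 4); rewrite ?leq_maxl ?leq_maxr.
have n0 : (0 < n)%N by exact: leq_trans n3.
have nR : 0 < n%:R :> R by rewrite ltr0n.
pose u : balg_ring A := (r / n%:R)%:C *: a.
have uE : u *+ n = r%:C *: a.
  rewrite -scaler_nat scalerA -(rmorph_nat (real_complex R)) -rmorphM.
  by rewrite mulrC divfK// gt_eqF.
have := roots_of_unity_average u n3.
set T := \sum_(5 <= j < n.+1) _; set S := \sum_(0 <= k < 4) _ => ST.
have T1 : rnorm (T : A) <= 2 * (r ^+ 5 / 5`!%:R).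
  apply: binomial_tail => //.
  - move=> j; rewrite -[4^-1%:C * _]/(4^-1%:C *: (_ : R[i]^o)) rnormZr//.
    by rewrite ler_pdivrMl// mulr1 sum_fourth_roots_le.
  - by rewrite r0 /r; lra.
  - by rewrite /u rnormZr ?a1 ?mulr1// divr_ge0.
have S1 : rnorm (S : A) <= \sum_(0 <= k < 4) (1 + 2 * (r * m k)).
  rewrite (le_trans (rnorm_sum _ _ _))// big_nat_cond [leRHS]big_nat_cond.
  apply: ler_sum => k /andP[/andP[_ k4] _]; have [m0 _] := H k k4.
  rewrite rnormZ rnorm_iX mul1r scalerA mulrC -scalerA.
  apply: le_trans (HN n Nn n0 k k4) _.
  apply: expR_le1D2x; rewrite mulr_ge0//=.
  by have := mP k k4; rewrite /r; lra.
have S2 : \sum_(0 <= k < 4) (1 + 2 * (r * m k)) = 4 + 3 * P.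
  rewrite big_split/= sumr_const_nat -mulr_sumr -mulr_sumr -/P.
  have -> : 1 *+ (4 - 0) = 4 :> R by [].
  by rewrite /r; field.
have rle : 4 * r <= rnorm (S : A) + 4 * rnorm (T : A).
  have -> : 4 * r = rnorm (S - 4%:C *: T : A).
    by rewrite ST uE scalerDr addrK !rnormZr ?a1 ?mulr1.
  by rewrite (le_trans (rnormD _ _))// rnormN rnormZr.
have f5 : 5`!%:R = 120 :> R by [].
rewrite f5 in T1; rewrite S2 in S1.
have r5 : r ^+ 5 = 243 / 32 by rewrite /r; field.
rewrite r5 in T1; rewrite /r in rle.
by clear - P3 T1 S1 rle; lra.
Qed.

End BalgRing.

(** * The duality between the algebra and its predual *)

Section DualNorm.
Variables (R : realType) (V : normedModType R[i]) (f : V -> R[i]^o).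
Hypothesis cf : cont_dual V f.

Let lf : linear f. Proof. by case: cf. Qed.

Lemma cont_dualD x y : f (x + y) = f x + f y.
Proof. by have := lf 1 x y; rewrite !scale1r. Qed.

Lemma cont_dual0 : f 0 = 0.
Proof. by apply: (addrI (f 0)); rewrite -cont_dualD !addr0. Qed.

Lemma cont_dualZ c x : f (c *: x) = c * f x.
Proof. by have := lf c x 0; rewrite cont_dual0 !addr0. Qed.

Lemma cont_dualB x y : f (x - y) = f x - f y.
Proof. by rewrite -scaleN1r cont_dualD cont_dualZ mulN1r. Qed.

Lemma cont_dual_sum I (r : seq I) (F : I -> V) :
  f (\sum_(j <- r) F j) = \sum_(j <- r) f (F j).
Proof.
elim: r => [|j r IH]; last by rewrite !big_cons cont_dualD IH.
by rewrite !big_nil cont_dual0.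
Qed.

Let norms := [set complex.Re `|f x| | x in [set x : V | `|x| <= 1]].

Let norms_has_sup : has_sup norms.
Proof.
split; first by exists (complex.Re `|f 0|), 0 => //=; rewrite normr0.
have [_ [M fM]] := (cont_dualP f).1 cf.
exists `|M|; apply/ubP => _ [x /= + <-]; rewrite rnormE -(rmorph1 (real_complex R)) lecR => x1.
apply: (le_trans (fM x)); apply: (le_trans (ler_norm _)).
by rewrite normrM ler_piMr// ger0_norm ?rnorm_ge0.
Qed.

Lemma le_dual_norm x : rnorm (f x) <= dual_norm f * rnorm x.
Proof.
have [x0|xn0] := eqVneq (rnorm x) 0.
  by rewrite (rnorm0_eq0 x0) cont_dual0 !rnorm0 mulr0.
have xp : 0 < rnorm x by rewrite lt_neqAle eq_sym xn0 rnorm_ge0.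
rewrite -ler_pdivrMr// mulrC -rnormZr ?invr_ge0 ?rnorm_ge0//.
rewrite -[_ *: _]/(_ * _) -cont_dualZ; apply: sup_upper_bound => //.
exists ((rnorm x)^-1%:C *: x); last by [].
by rewrite /= rnormE rnormZr ?invr_ge0 ?rnorm_ge0// mulVf.
Qed.

Lemma dual_norm_le M : 0 <= M -> (forall x, complex.Re (f x) <= M * rnorm x) ->
  dual_norm f <= M.
Proof.
move=> M0 fM; apply: ge_sup; first by case: norms_has_sup.
apply/ubP => _ [x /= + <-]; rewrite rnormE -(rmorph1 (real_complex R)) lecR => x1.
have [c c1 cz] := exists_rotation (f x).
have := fM (c *: x); rewrite cont_dualZ cz rnormZ c1 mul1r /= => /le_trans; apply.
by rewrite ler_piMr.
Qed.

Lemma dual_norm_approx e : 0 < e ->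
  exists2 x, rnorm x <= 1 & dual_norm f - e < complex.Re (f x).
Proof.
move=> e0; have [_ [x /= x1 <-] lt] := sup_adherent e0 norms_has_sup.
have [c c1 cz] := exists_rotation (f x); exists (c *: x); last by rewrite cont_dualZ cz.
by rewrite rnormZ c1 mul1r -lecR -rnormE.
Qed.

End DualNorm.

Section DualPair.
Variables (R : realType) (A : banachAlgType R[i]).
Hypothesis norm1 : `|balg_one A| = 1.
Variables (E : completeNormedModType R[i]) (J : A -> E -> R[i]^o).
Hypothesis dualJ : is_dual_of J.
Local Notation Re := complex.Re.
Local Notation one := (balg_one A).
Implicit Types (a b : A) (x y : E).

Lemma J_dual a : cont_dual E (J a).
Proof. by case: dualJ => _ <- _; exists a. Qed.

Lemma rnorm_J a : rnorm a = dual_norm (J a).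
Proof. by case: dualJ => _ _ nJ; rewrite /rnorm nJ. Qed.

Lemma JD a b x : J (a + b) x = J a x + J b x.
Proof.
case: dualJ => lJ _ _.
by have := congr1 (@^~ x) (lJ 1 a b); rewrite !scale1r.
Qed.

Lemma J0 x : J 0 x = 0.
Proof. by apply: (addrI (J 0 x)); rewrite -JD !addr0. Qed.

Lemma JZ c a x : J (c *: a) x = c * J a x.
Proof.
case: dualJ => lJ _ _.
by rewrite -[c *: a]addr0 (lJ c a 0) -[LHS]/(c * J a x + J 0 x) J0 addr0.
Qed.

Lemma norm_J_le a x : rnorm (J a x) <= rnorm a * rnorm x.
Proof. by rewrite rnorm_J; apply: le_dual_norm (J_dual a) x. Qed.

Lemma Re_J_le a x : Re (J a x) <= rnorm a * rnorm x.
Proof. exact: le_trans (Re_le_rnorm _) (norm_J_le a x). Qed.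

Lemma evaluation_dual x : cont_dual A (fun a => J a x).
Proof.
apply/cont_dualP; split; first by move=> c a b; rewrite JD JZ.
by exists (rnorm x) => a; rewrite mulrC; exact: norm_J_le.
Qed.

Lemma Re_J_geN a x : - (rnorm a * rnorm x) <= Re (J a x).
Proof.
rewrite lerNl; apply: le_trans (norm_J_le a x); rewrite -rnormN.
by apply: le_trans (Re_le_rnorm _); case: (J a x).
Qed.

Lemma Re_J_approx a e : 0 < e -> exists2 x, rnorm x <= 1 & rnorm a - e < Re (J a x).
Proof. by rewrite rnorm_J; exact: dual_norm_approx (J_dual a) e. Qed.

Lemma Re_JZ (r : R) a x : Re (J a (r%:C *: x)) = r * Re (J a x).
Proof. by rewrite (cont_dualZ (J_dual a)); case: (J a x) => u v /=; ring. Qed.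

Lemma Re_JZl (r : R) a x : Re (J (r%:C *: a) x) = r * Re (J a x).
Proof. by rewrite JZ; case: (J a x) => u v /=; ring. Qed.

Lemma Re_JD a x y : Re (J a (x + y)) = Re (J a x) + Re (J a y).
Proof. by rewrite (cont_dualD (J_dual a)) raddfD. Qed.

Lemma Re_JB a x y : Re (J a (x - y)) = Re (J a x) - Re (J a y).
Proof. by rewrite (cont_dualB (J_dual a)) raddfB. Qed.

Lemma Re_J1_le x : Re (J one x) <= rnorm x.
Proof. by have := Re_J_le one x; rewrite [rnorm one](rnorm1 norm1) mul1r. Qed.

(** Since [A] is the whole dual of [E], it separates points from convex sets. *)
Lemma J_separation (S : set E) x e : S !=set0 ->
    (forall (t : R) y z, 0 <= t <= 1 -> S y -> S z ->
       S (t%:C *: y + (1 - t)%:C *: z)) ->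
    (forall y, S y -> e <= rnorm (x - y)) ->
  exists a, rnorm a <= 1 /\ forall y, S y -> Re (J a y) + e <= Re (J a x).
Proof.
move=> S0 Sc Sfar; have [g [cg g1 gS]] := separation S0 Sc Sfar.
have [a _ Ja] : range J g by case: dualJ => _ -> _.
exists a; rewrite Ja; split=> //; rewrite rnorm_J Ja.
by apply: dual_norm_le => // z; rewrite mul1r.
Qed.

(** A slice of the unit ball of [E] on which the unit of [A] is almost maximal;
    its points are the approximate normal states. *)
Definition slice (d : R) := [set x : E | rnorm x <= 1 /\ 1 - d < Re (J one x)].

Lemma slice_nonempty d : 0 < d -> slice d !=set0.
Proof.
move=> d0; have [x x1 lt] := Re_J_approx one d0; exists x; split=> //.
by move: lt; rewrite [rnorm one](rnorm1 norm1).
Qed.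

Lemma slice_convex d (t : R) y z : 0 <= t <= 1 -> slice d y -> slice d z ->
  slice d (t%:C *: y + (1 - t)%:C *: z).
Proof.
move=> /andP[t0 t1] [y1 yd] [z1 zd]; have t10 : 0 <= 1 - t by lra.
split.
  by rewrite (le_trans (rnormD _ _))// !rnormZr//; nra.
rewrite Re_JD !Re_JZ.
by have [->|tn0] := eqVneq t 0; nra.
Qed.

(** Points outside the slice cannot nearly attain the norm of [1 + s a] for
    small [s], so the growth of that norm is decided on the slice. *)
Lemma slice_growth a d m : 0 < d -> (forall x, slice d x -> Re (J a x) <= m) ->
  unit_growth (a : balg_ring A) m.
Proof.
move=> d0 H; have N0 := rnorm_ge0 a; pose N := rnorm a + 1.
have Np : 0 < N by rewrite /N; lra.
exists (d / (2 * N)); first by rewrite divr_gt0// mulr_gt0.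
move=> s /andP[s0]; rewrite ler_pdivlMr ?mulr_gt0// => sd.
apply/ler_addgt0Pr => e e0.
have [x x1 lt] := Re_J_approx (s%:C *: a + one) e0.
rewrite JD raddfD /= Re_JZl in lt.
have [x0 Sx0] := slice_nonempty d0.
have mN : - rnorm a <= m.
  apply: le_trans (H _ Sx0); apply: le_trans (Re_J_geN a x0).
  by rewrite lerN2 ler_piMr//; case: Sx0.
have ax : Re (J a x) <= rnorm a by rewrite (le_trans (Re_J_le a x))// ler_piMr.
have ox : Re (J one x) <= 1 := le_trans (Re_J1_le x) x1.
rewrite -[X in rnorm X]/(s%:C *: a + one).
have [xd|xd] := ltP (1 - d) (Re (J one x)).
  have := H x (conj x1 xd); nra.
rewrite /N in sd; nra.
Qed.

End DualPair.

(** * Existence of normal states *)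

Section NormalStates.
Variables (R : realType) (A : banachAlgType R[i]).
Hypothesis norm1 : `|balg_one A| = 1.
Variables (E : completeNormedModType R[i]) (J : A -> E -> R[i]^o).
Hypothesis dualJ : is_dual_of J.
Local Notation Re := complex.Re.
Local Notation one := (balg_one A).
Implicit Types (a b : A) (x y : E).

(** The distance from a point of a slice to a thinner slice is bounded
    independently of the thinner one. If [x] were far from it, a separating [a]
    would make [|1 + t a|] larger at [x] than its uniform quadratic expansion,
    whose linear term is computed on the thin slice, permits. *)
Lemma slice_step (t d : R) x : 0 < t <= 1 / 2 -> 0 < d -> slice J (t ^+ 2) x ->
  exists2 y, slice J d y & rnorm (x - y) < 5 * t.
Proof.
move=> /andP[t0 t2] d0 [x1 xt]; apply: contrapT => far.
have Sfar y : slice J d y -> 5 * t <= rnorm (x - y).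
  by move=> Sy; rewrite leNgt; apply/negP => lt; apply: far; exists y.
have [y0 Sy0] := slice_nonempty norm1 dualJ d0.
have [a [a1 aS]] := J_separation dualJ (ex_intro _ y0 Sy0)
  (slice_convex dualJ (d := d)) Sfar.
(* Evaluating 1 + t a at x gives 5 t^2 <= t^2 + 3 t^2 below, t^2 being the
   depth of the slice of x. *)
pose m := Re (J a x) - 5 * t.
have ga : unit_growth (a : balg_ring A) m.
  by apply: (slice_growth norm1 dualJ d0) => y /aS; rewrite /m; lra.
have m1 : `|m| <= 1.
  have h1 : Re (J a x) <= 1.
    by rewrite (le_trans (Re_J_le dualJ a x))// mulr_ile1 ?rnorm_ge0.
  have h2 : - 1 <= Re (J a y0).
    apply: le_trans (Re_J_geN dualJ a y0); rewrite lerN2.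
    by case: Sy0 => y01 _; rewrite mulr_ile1 ?rnorm_ge0.
  by have := aS y0 Sy0; rewrite ler_norml /m => h3; apply/andP; split; lra.
have t02 : 0 <= t <= 1 / 2 by rewrite (ltW t0).
have := unit_growth_quadratic norm1 ga a1 m1 t02.
have : Re (J (t%:C *: a + one) x) <= rnorm (t%:C *: a + one).
  by rewrite (le_trans (Re_J_le dualJ _ x))// ler_piMr ?rnorm_ge0.
rewrite (JD dualJ) raddfD /= (Re_JZl dualJ).
rewrite -[rnorm (_ : balg_ring A)]/(rnorm (t%:C *: a + one)).
by rewrite /m; nra.
Qed.

(** Elements of [E] that evaluation turns into normal states. *)
Definition state_vector := [set y : E | rnorm y <= 1 /\ 1 <= Re (J one y)].

(** Iteration of the previous step with the depths [(t / 2^n)^2]: the steps have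
    length at most [5 t / 2^n], and the limit lies in all slices. *)
Lemma state_vector_near (t : R) x : 0 < t <= 1 / 2 -> slice J (t ^+ 2) x ->
  exists2 y, state_vector y & rnorm (x - y) <= 10 * t.
Proof.
move=> /andP[t0 t2] Sx; pose T n : R := t * (1 / 2) ^+ n.
have T0 n : 0 < T n by rewrite mulr_gt0// exprn_gt0// divr_gt0.
have Tle n : T n <= t by rewrite ler_piMr ?(ltW t0)// exprn_ile1//; lra.
have next (z : nat * E) : exists y, slice J (T z.1 ^+ 2) z.2 ->
    slice J (T z.1.+1 ^+ 2) y /\ rnorm (z.2 - y) < 5 * T z.1.
  have [Sz|] := pselect (slice J (T z.1 ^+ 2) z.2); last by exists 0.
  have Tz : 0 < T z.1 <= 1 / 2 by rewrite T0 (le_trans (Tle _)).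
  have [y Sy ly] := slice_step Tz (exprn_gt0 2 (T0 z.1.+1)) Sz.
  by exists y.
have [F HF] := choice next.
pose u := fix u n := if n is k.+1 then F (k, u k) else x.
have Su n : slice J (T n ^+ 2) (u n).
  elim: n => [|n IH]; first by rewrite /T expr0 mulr1.
  by have [] := HF (n, u n) IH.
have uq n : rnorm (u n.+1 - u n) <= 5 * t * (1 / 2) ^+ n.
  by rewrite rnorm_distC -mulrA ltW//; have [] := HF (n, u n) (Su n).
have q01 : 0 <= (1 / 2 : R) < 1 by apply/andP; split; lra.
have [l ul] := geometric_limit q01 uq.
have {}ul n : rnorm (u n - l) <= 10 * t * (1 / 2) ^+ n.
  by apply: le_trans (ul n) _; rewrite le_eqVlt; apply/orP; left; apply/eqP; field.
exists l; last by have := ul 0; rewrite expr0 mulr1.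
split; apply/ler_addgt0Pr => e e0.
  have [N _ /(_ N (leqnn N)) /= HN] := geometric_small (10 * t) q01 e0.
  have -> : l = u N - (u N - l) by rewrite opprB addrC subrK.
  apply: (le_trans (rnormD _ _)); rewrite rnormN; apply: lerD.
    by case: (Su N).
  exact: le_trans (ul N) (ltW HN).
have [N _ /(_ N (leqnn N)) /= HN] := geometric_small (t + 10 * t) q01 e0.
have [_ uN] := Su N.
have h : Re (J one (u N)) - Re (J one l) <= 10 * t * (1 / 2) ^+ N.
  by rewrite -(Re_JB dualJ) (le_trans (Re_J1_le norm1 dualJ _)).
have TN : T N ^+ 2 <= t * (1 / 2) ^+ N.
  rewrite -/(T N) expr2 ler_piMr ?(ltW (T0 N))//; have := Tle N; lra.
by rewrite mulrDl in HN; lra.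
Qed.

(** Numerical ranges can be computed with normal states only. *)
Lemma state_growth a m e : 0 < e ->
    (forall y, state_vector y -> Re (J a y) <= m) ->
  unit_growth (a : balg_ring A) (m + e).
Proof.
move=> e0 H; have N0 := rnorm_ge0 a; pose N := 10 * (rnorm a + 1).
have Np : 0 < N by rewrite /N; lra.
pose t := Num.min (1 / 2) (e / N).
have t0 : 0 < t by rewrite lt_min divr_gt0// divr_gt0.
have t2 : t <= 1 / 2 by rewrite ge_min lexx.
have tN : t * N <= e by rewrite -ler_pdivlMr// ge_min lexx orbT.
apply: (slice_growth norm1 dualJ (exprn_gt0 2 t0)) => x Sx.
have [|y Sy xy] := state_vector_near _ Sx; first by rewrite t0.
have -> : x = y + (x - y) by rewrite addrC subrK.
rewrite (Re_JD dualJ); apply: lerD; first exact: H.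
apply: (le_trans (Re_J_le dualJ _ _)); apply: le_trans tN.
apply: (le_trans (ler_wpM2l N0 xy)); rewrite /N; nra.
Qed.

Lemma state_vector_exists : state_vector !=set0.
Proof.
have h : 0 < (1 / 2 : R) <= 1 / 2 by rewrite divr_gt0//=.
have [x Sx] := slice_nonempty norm1 dualJ (exprn_gt0 2 (andP h).1).
by have [y Sy _] := state_vector_near h Sx; exists y.
Qed.

(** The vectors that evaluate to [t] times a normal state with [0 <= t <= 1];
    this description makes convexity and closedness immediate. *)
Definition substate := [set y : E | rnorm y <= Re (J one y) <= 1].

Lemma substate0 : substate 0.
Proof. by rewrite /substate /= (cont_dual0 (J_dual dualJ one)) rnorm0 /= lexx ler01. Qed.

Lemma substate_convex (t : R) y z : 0 <= t <= 1 -> substate y -> substate z ->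
  substate (t%:C *: y + (1 - t)%:C *: z).
Proof.
move=> /andP[t0 t1] /andP[y1 y2] /andP[z1 z2]; have t10 : 0 <= 1 - t by lra.
rewrite /substate/= (Re_JD dualJ) !(Re_JZ dualJ); apply/andP; split; last by nra.
rewrite (le_trans (rnormD _ _))// !rnormZr//; nra.
Qed.

Lemma state_substate y : state_vector y -> substate y.
Proof.
move=> [y1 yJ]; rewrite /substate /= (le_trans y1 yJ)/=.
exact: le_trans (Re_J1_le norm1 dualJ y) y1.
Qed.

Lemma state_vector_normal y : state_vector y -> normal_states J (fun a => J a y).
Proof.
move=> [y1 Jy]; split; last by exists y.
have cy := evaluation_dual dualJ y.
split=> //.
  apply: dual_norm_le => // a; apply: (le_trans (Re_J_le dualJ a y)).
  by rewrite mulrC ler_wpM2r// rnorm_ge0.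
have J1 : rnorm (J one y) <= 1.
  apply: (le_trans (norm_J_le dualJ one y)).
  by rewrite [rnorm one](rnorm1 norm1) mul1r.
move: Jy J1; rewrite /rnorm normc_def /=; case: (J one y) => u v /= u1.
move=> uv; have {}uv : u ^+ 2 + v ^+ 2 <= 1.
  by rewrite -[leLHS]sqr_sqrtr ?addr_ge0 ?sqr_ge0// expr_le1// sqrtr_ge0.
have v2 := sqr_ge0 v; have u01 : u = 1 by nra.
have v0 : v ^+ 2 = 0 by rewrite u01 in uv; lra.
by apply/eqP; rewrite eq_complex /= u01 eqxx -sqrf_eq0 v0 eqxx.
Qed.

Lemma substate_normal y : substate y ->
  exists t : R, exists omega, [/\ 0 <= t <= 1, normal_states J omega &
    forall a, J a y = t%:C * omega a].
Proof.
move=> /andP[y1 Jy]; have t0 : 0 <= Re (J one y) := le_trans (rnorm_ge0 y) y1.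
exists (Re (J one y)).
have [tz|tn0] := eqVneq (Re (J one y)) 0.
  have [z Sz] := state_vector_exists.
  exists (fun a => J a z); split; [by rewrite t0|exact: state_vector_normal|].
  move=> a; rewrite tz rmorph0 mul0r (_ : y = 0) ?(cont_dual0 (J_dual dualJ a))//.
  by apply: rnorm0_eq0; apply/eqP; rewrite eq_le rnorm_ge0 andbT -tz.
set t := Re _ in y1 Jy t0 tn0 *.
have tp : 0 < t by rewrite lt_neqAle eq_sym tn0.
exists (fun a => J a (t^-1%:C *: y)); split; [by rewrite t0| |].
  apply: state_vector_normal; split.
    by rewrite rnormZr ?invr_ge0// ler_pdivrMl// mulr1.
  by rewrite (Re_JZ dualJ) -/t mulVf.
move=> a; rewrite (cont_dualZ (J_dual dualJ a)) mulrA -rmorphM divff//.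
by rewrite rmorph1 mul1r.
Qed.

End NormalStates.

(** * Combinations of four normal states *)

Section Decomposition.
Variables (R : realType) (A : banachAlgType R[i]).
Hypothesis norm1 : `|balg_one A| = 1.
Variables (E : completeNormedModType R[i]) (J : A -> E -> R[i]^o).
Hypothesis dualJ : is_dual_of J.
Local Notation Re := complex.Re.
Local Notation one := (balg_one A).
Implicit Types (a b : A) (x y : E).

Definition substate_support a := sup [set Re (J a y) | y in substate J].

Lemma substate_has_sup a : has_sup [set Re (J a y) | y in substate J].
Proof.
split; first by exists (Re (J a 0)), 0 => //; exact: substate0.
exists (rnorm a); apply/ubP => _ [y /andP[y1 Jy] <-].
rewrite (le_trans (Re_J_le dualJ a y))// ler_piMr ?rnorm_ge0//.
exact: le_trans y1 Jy.
Qed.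

Lemma le_substate_support a y : substate J y -> Re (J a y) <= substate_support a.
Proof. by move=> Sy; apply: sup_upper_bound; [exact: substate_has_sup|exists y]. Qed.

Lemma substate_support_ge0 a : 0 <= substate_support a.
Proof.
have := le_substate_support a (substate0 dualJ).
by rewrite (cont_dual0 (J_dual dualJ a)).
Qed.

(** The growth of the norm at the unit is decided by the normal states, so the
    lower bound for the numerical radius becomes one for normal states. *)
Lemma norm_le_support a :
  rnorm a <= 3 * \sum_(0 <= k < 4) substate_support ('i%C ^+ k *: a).
Proof.
apply/ler_addgt0Pr => e e0.
pose m k := substate_support ('i%C ^+ k *: a) + e / 12.
have e12 : 0 < e / 12 by rewrite divr_gt0.
have := @numerical_radius _ _ norm1 (a : balg_ring A) m _.
rewrite /m big_split/= sumr_const_nat mulrDr.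
have -> : 3 * (e / 12 *+ (4 - 0)) = e by rewrite subn0 -mulr_natr; field.
apply=> k _; split; first by rewrite addr_ge0 ?substate_support_ge0// ltW.
apply: (state_growth norm1 dualJ e12) => y Sy; apply: le_substate_support.
exact: state_substate.
Qed.

Definition four_substates := [set x : E | exists2 y : nat -> E,
  (forall k, substate J (y k)) & x = \sum_(0 <= k < 4) 'i%C ^+ k *: y k].

Lemma Re_J_four a (y : nat -> E) : Re (J a (\sum_(0 <= k < 4) 'i%C ^+ k *: y k)) =
  \sum_(0 <= k < 4) Re (J ('i%C ^+ k *: a) (y k)).
Proof.
rewrite (cont_dual_sum (J_dual dualJ a)) raddf_sum; apply: eq_bigr => k _.
by rewrite (cont_dualZ (J_dual dualJ a)) (JZ dualJ).
Qed.

Lemma four_substates_convex (t : R) x z : 0 <= t <= 1 ->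
  four_substates x -> four_substates z ->
  four_substates (t%:C *: x + (1 - t)%:C *: z).
Proof.
move=> t01 [y Sy ->] [w Sw ->].
exists (fun k => t%:C *: y k + (1 - t)%:C *: w k).
  by move=> k; exact: substate_convex.
rewrite !scaler_sumr -big_split; apply: eq_bigr => k _ /=.
by rewrite scalerDr !scalerA ![_ * 'i%C ^+ k]mulrC.
Qed.

(** By separation: the support function of the set of combinations of four
    substates at [a] is the sum bounded below in [norm_le_support]. *)
Lemma four_substates_dense x g e : 0 < g ->
    (forall a, Re (J a x) <= g / 3 * rnorm a) -> 0 < e ->
  exists2 y : nat -> E, (forall k, substate J (y k)) &
    rnorm (x - g%:C *: \sum_(0 <= k < 4) 'i%C ^+ k *: y k) < e.
Proof.
move=> g0 xg e0; apply: contrapT => far.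
pose d := e / g; have d0 : 0 < d by rewrite divr_gt0.
have gC : g%:C != 0 :> R[i] by rewrite eq_complex/= eqxx andbT gt_eqF.
have Sfar z : four_substates z -> d <= rnorm (g^-1%:C *: x - z).
  move=> [y Sy ->]; rewrite /d ler_pdivrMr// mulrC -rnormZr ?(ltW g0)//.
  rewrite scalerBr scalerA -rmorphM divff ?gt_eqF// rmorph1 scale1r.
  by rewrite leNgt; apply/negP => lt; apply: far; exists y.
have S0 : four_substates !=set0.
  exists (\sum_(0 <= k < 4) 'i%C ^+ k *: (fun=> 0) k), (fun=> 0) => // k.
  exact: substate0.
have [a [_ aS]] := J_separation dualJ S0 four_substates_convex Sfar.
have d40 : 0 < d / 4 by rewrite divr_gt0.
have near k : exists y, substate J y /\
    substate_support ('i%C ^+ k *: a) - d / 4 < Re (J ('i%C ^+ k *: a) y).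
  by have [_ [y Sy <-] lt] := sup_adherent d40 (substate_has_sup ('i%C ^+ k *: a)); exists y.
have [y Hy] := choice near.
have := aS _ (ex_intro2 _ _ y (fun k => (Hy k).1) erefl).
rewrite Re_J_four (Re_JZ dualJ).
have : g^-1 * Re (J a x) <= 3^-1 * rnorm a.
  by rewrite ler_pdivrMl// mulrA.
have := norm_le_support a.
rewrite 8?big_nat_recr//= !big_geq//.
by have := (Hy 0).2; have := (Hy 1).2; have := (Hy 2).2; have := (Hy 3).2; lra.
Qed.

(** The approximation improves to an equality: the remainders, corrected by a
    geometrically decreasing sequence of multiples of combinations of four
    substates, tend to zero, and the corrections sum up to substates. *)
Lemma four_substates_ball x c : 0 < c < 1 / 3 ->
  (forall a, Re (J a x) <= c * rnorm a) -> four_substates x.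
Proof.
move=> /andP[c0 c3] xc; pose q : R := 1 - 3 * c.
have q0 : 0 < q by rewrite /q; lra.
have q1 : 0 < 1 - q by rewrite /q; lra.
(* These coefficients sum up to 1, so that the partial sums s k n below stay
   substates; and g 0 / 3 = c. *)
pose g n : R := (1 - q) * q ^+ n.
have g0 n : 0 < g n by rewrite mulr_gt0// exprn_gt0.
have step (z : nat * E) : exists y : nat -> E,
    (forall a, Re (J a z.2) <= g z.1 / 3 * rnorm a) ->
    (forall k, substate J (y k)) /\
    rnorm (z.2 - (g z.1)%:C *: \sum_(0 <= k < 4) 'i%C ^+ k *: y k) < g z.1.+1 / 3.
  have [zg|] := pselect (forall a, Re (J a z.2) <= g z.1 / 3 * rnorm a).
    have e0 : 0 < g z.1.+1 / 3 by rewrite divr_gt0.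
    by have [y Sy ly] := four_substates_dense (g0 z.1) zg e0; exists y.
  by exists (fun=> 0).
have [F HF] := choice step.
pose r := fix r n := if n is k.+1 then
  r k - (g k)%:C *: \sum_(0 <= j < 4) 'i%C ^+ j *: F (k, r k) j else x.
have rg n a : Re (J a (r n)) <= g n / 3 * rnorm a.
  elim: n a => [|n IH] a.
    apply: le_trans (xc a) _; rewrite /g expr0 mulr1 /q.
    by rewrite ler_wpM2r ?rnorm_ge0//; lra.
  have [_ /ltW h] := HF (n, r n) IH.
  apply: (le_trans (Re_J_le dualJ _ _)); rewrite mulrC.
  by rewrite ler_wpM2r ?rnorm_ge0.
have SF n k : substate J (F (n, r n) k) by have [] := HF (n, r n) (rg n).
pose s k n := \sum_(0 <= j < n) (g j)%:C *: F (j, r j) k.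
have sS k n : s k n.+1 = s k n + (g n)%:C *: F (n, r n) k.
  by rewrite /s big_nat_recr.
have rE n : x = r n + \sum_(0 <= k < 4) 'i%C ^+ k *: s k n.
  elim: n => [|n IH].
    rewrite /= big1 ?addr0// => k _.
    by rewrite /s big_geq// scaler0.
  rewrite [LHS]IH /= -addrA; congr (_ + _).
  rewrite scaler_sumr -sumrN -big_split; apply: eq_bigr => k _ /=.
  by rewrite sS scalerDr [RHS]addrCA !scalerA [(g n)%:C * _]mulrC addNr addr0.
have sb k n : rnorm (s k n) <= Re (J one (s k n)) <= 1 - q ^+ n.
  elim: n => [|n /andP[IH1 IH2]].
    by rewrite /s big_geq// (cont_dual0 (J_dual dualJ one)) rnorm0 expr0 subrr /= lexx.
  have /andP[y1 y2] := SF n k.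
  rewrite sS (Re_JD dualJ) (Re_JZ dualJ); apply/andP; split.
    by rewrite (le_trans (rnormD _ _))// lerD// rnormZr ?(ltW (g0 n))// ler_wpM2l// ltW.
  have : g n * Re (J one (F (n, r n) k)) <= g n by rewrite ler_piMr// ltW.
  by rewrite {2}/g exprS; lra.
have q01 : 0 <= q < 1 by apply/andP; split; lra.
have lim k : exists l, forall n, rnorm (s k n - l) <= q ^+ n.
  have sq n : rnorm (s k n.+1 - s k n) <= (1 - q) * q ^+ n.
    rewrite sS addrAC subrr add0r rnormZr ?(ltW (g0 n))// ler_piMr ?(ltW (g0 n))//.
    by have /andP[y1 /(le_trans y1)] := SF n k.
  have [l Hl] := geometric_limit q01 sq; exists l => n.
  by apply: le_trans (Hl n) _; rewrite mulrAC divff ?mul1r// gt_eqF.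
have [l Hl] := choice lim.
have small e : 0 < e -> exists n, 5 * q ^+ n < e.
  by move=> /(geometric_small 5 q01)[N _ /(_ N (leqnn N))]; exists N.
exists l.
  move=> k; have near e : 0 < e -> exists n, rnorm (s k n - l k) < e.
    move=> /small[n ln]; exists n; apply: le_lt_trans (Hl k n) _.
    have := exprn_ge0 n (ltW q0); lra.
  have Jnear n : Re (J one (s k n)) - Re (J one (l k)) <= rnorm (s k n - l k) /\
                 Re (J one (l k)) - Re (J one (s k n)) <= rnorm (s k n - l k).
    by split; [|rewrite rnorm_distC]; rewrite -(Re_JB dualJ) Re_J1_le.
  have lle n : rnorm (l k) <= rnorm (s k n) + rnorm (s k n - l k).
    by rewrite -{1}(subKr (s k n) (l k)) (le_trans (rnormD _ _))// rnormN.
  apply/andP; split; apply/ler_addgt0Pr => e e0.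
    have e20 : 0 < e / 2 by lra.
    have [n ln] := near _ e20; have := lle n; have := (Jnear n).1.
    by have /andP[] := sb k n; lra.
  have [n ln] := near _ e0; have := (Jnear n).2; have /andP[_] := sb k n.
  by have := exprn_ge0 n (ltW q0); lra.
apply/eqP; rewrite -subr_eq0; apply/eqP; apply: rnorm0_eq0; apply/eqP.
rewrite eq_le rnorm_ge0 andbT; apply/ler_addgt0Pr => e e0; rewrite add0r.
have [n ln] := small e e0; rewrite {1}(rE n.+1) -addrA -sumrB.
apply: le_trans (ltW ln); apply: (le_trans (rnormD _ _)).
have rn : rnorm (r n.+1) <= q ^+ n.
  have [_ /ltW] := HF (n, r n) (rg n); move=> /le_trans; apply.
  rewrite /g exprS; have := exprn_ge0 n (ltW q0).
  move: (q ^+ n) => Q Q0; have : 0 <= q * Q by rewrite mulr_ge0// ltW.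
  move=> h; have : q * Q <= Q by rewrite ler_piMl//; lra.
  by have : q * (q * Q) >= 0; [rewrite mulr_ge0// ltW|lra].
have sl : rnorm (\sum_(0 <= k < 4) ('i%C ^+ k *: s k n.+1 - 'i%C ^+ k *: l k)) <= 4 * q ^+ n.
  apply: (le_trans (rnorm_sum _ _ _)).
  apply: (@le_trans _ _ (\sum_(0 <= k < 4) q ^+ n)).
    apply: ler_sum => k _; rewrite -scalerBr rnormZ rnorm_iX mul1r.
    apply: (le_trans (Hl k _)); rewrite exprS ler_piMl ?exprn_ge0 ?(ltW q0)//; lra.
  by rewrite sumr_const_nat mulr_natl.
lra.
Qed.

End Decomposition.

(** * The span of the normal states *)

Lemma three_lt_e_sqrt2 (R : realType) : 3 < expR 1 * Num.sqrt 2 :> R.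
Proof.
have s2 : 7 / 5 < Num.sqrt 2 :> R.
  have p : 0 <= 7 / 5 :> R by rewrite divr_ge0.
  by rewrite -[ltLHS](ger0_norm p) -sqrtr_sqr ltr_sqrt ?ltr0n// expr2; lra.
have e1 : 9 / 4 <= expR 1 :> R.
  have -> : expR 1 = expR (1 / 2) * expR (1 / 2) :> R.
    by rewrite -expRD; congr expR; lra.
  by have := expR_ge1Dx (1 / 2 : R); move: (expR _) => z; nra.
move: (expR 1) (Num.sqrt 2) s2 e1 => u v; nra.
Qed.

Section NormalFunctionals.
Variables (R : realType) (A : banachAlgType R[i]).
Hypothesis norm1 : `|balg_one A| = 1.
Variables (E : completeNormedModType R[i]) (J : A -> E -> R[i]^o).
Hypothesis dualJ : is_dual_of J.

Lemma four_substates_normal x : four_substates J x ->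
  exists (t : nat -> R) (omega : nat -> A -> R[i]^o),
    [/\ forall k, 0 <= t k <= 1, forall k, normal_states J (omega k) &
      (fun a => J a x) = \sum_(0 <= k < 4) ('i%C ^+ k * (t k)%:C) *: omega k].
Proof.
move=> [y Sy ->].
have [t /choice[omega H]] := choice (fun k => substate_normal norm1 dualJ (Sy k)).
exists t, omega; split=> [k|k|]; [by case: (H k)|by case: (H k)|].
apply/funext => a; rewrite (cont_dual_sum (J_dual dualJ a)) fct_sumE.
apply: eq_bigr => k _; rewrite (cont_dualZ (J_dual dualJ a)).
by have [_ _ ->] := H k; rewrite mulrA.
Qed.

Lemma lin_span_sub_predual : lin_span (normal_states J) `<=` predual J.
Proof.
move=> _ [n [c [s [Ss ->]]]].
have /choice[x Hx] j : exists x, s j = fun a => J a x.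
  by have [_ [x _ <-]] := Ss j; exists x.
exists (\sum_j c j *: x j) => //; apply/funext => a.
rewrite (cont_dual_sum (J_dual dualJ a)) fct_sumE; apply: eq_bigr => j _.
by rewrite (cont_dualZ (J_dual dualJ a)) Hx.
Qed.

(** A small multiple of any functional is a combination of four normal states. *)
Lemma predual_sub_lin_span : predual J `<=` lin_span (normal_states J).
Proof.
move=> _ [x _ <-]; pose s : R := (6 * (rnorm x + 1))^-1.
have x0 := rnorm_ge0 x; have s0 : 0 < s by rewrite invr_gt0; lra.
have sx : s * rnorm x <= 1 / 6 by rewrite /s ler_pdivrMl; lra.
have Kx : four_substates J (s%:C *: x).
  apply: (@four_substates_ball _ _ norm1 _ _ dualJ _ (1 / 6)); first by apply/andP; split; lra.
  move=> a; apply: (le_trans (Re_J_le dualJ a _)).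
  by rewrite rnormZr ?(ltW s0)// mulrC ler_wpM2r ?rnorm_ge0.
have [t [omega [_ nomega E4]]] := four_substates_normal Kx.
exists 4, (fun k : 'I_4 => s^-1%:C * ('i%C ^+ k * (t k)%:C)), (fun k : 'I_4 => omega k).
split; first by move=> k; exact: nomega.
transitivity (s^-1%:C *: (fun a => J a (s%:C *: x))).
  apply/funext => a; rewrite fctE (cont_dualZ (J_dual dualJ a)).
  by rewrite /GRing.scale/= mulrA -rmorphM mulVf ?gt_eqF// rmorph1 mul1r.
rewrite E4 scaler_sumr big_mkord; apply: eq_bigr => k _.
by rewrite scalerA.
Qed.

End NormalFunctionals.

Theorem theorem2p4 (R : realType) (A : banachAlgType R[i])
    (normA1 : `|balg_one A| = 1)
    (E : completeNormedModType R[i]) (J : A -> E -> R[i]^o)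
    (dualJ : is_dual_of J) :
  lin_span (normal_states J) = predual J /\
  forall omega : A -> R[i]^o, predual J omega ->
    dual_norm omega < (expR 1 * Num.sqrt 2)^-1 ->
    exists (t1 t2 t3 t4 : R) (omega1 omega2 omega3 omega4 : A -> R[i]^o),
      [/\ t1 \in `[0, 1], t2 \in `[0, 1], t3 \in `[0, 1] & t4 \in `[0, 1]] /\
      [/\ normal_states J omega1, normal_states J omega2,
          normal_states J omega3 & normal_states J omega4] /\
      omega = t1%:C *: omega1 - t2%:C *: omega2
              + 'i%C *: (t3%:C *: omega3 - t4%:C *: omega4).
Proof.
split.
  apply/seteqP; split; first exact: lin_span_sub_predual.
  exact: predual_sub_lin_span.
move=> _ [x _ <-] small; set c := _^-1 in small.
have e3 := three_lt_e_sqrt2 R.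
have c13 : 0 < c < 1 / 3.
  rewrite /c invr_gt0 mul1r ltf_pV2 ?posrE; [|by lra|by lra].
  by apply/andP; split; lra.
have Kx : four_substates J x.
  apply: (four_substates_ball normA1 dualJ c13) => a.
  apply: (le_trans (Re_le_rnorm _)).
  apply: (le_trans (le_dual_norm (evaluation_dual dualJ x) a)).
  by rewrite ler_wpM2r ?rnorm_ge0// ltW.
have [t [omega [t01 nomega ->]]] := four_substates_normal normA1 dualJ Kx.
exists (t 0), (t 2), (t 1), (t 3), (omega 0), (omega 2), (omega 1), (omega 3).
split; [by split; rewrite in_itv /= t01|split; first by split].
have i2 : 'i%C ^+ 2 = - 1 :> R[i] by exact: sqr_i.
have i3 : 'i%C ^+ 3 = - 'i%C :> R[i] by rewrite exprS i2 mulrN1.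
rewrite 4?big_nat_recr//= big_geq// add0r i3 i2 expr0 expr1 mul1r.
rewrite mulN1r mulNr !scaleNr -!scalerA scalerBr.
by rewrite -!addrA; congr (_ + _); rewrite addrCA.
Qed.
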